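(* Let $\mathcal{H}$ be a hypergraph, let $J(\mathcal{H})$ be its cover ideal, let $\chi(\mathcal{H})$ be the chromatic number of $\mathcal{H}$, and let $h$ be the big height of $J(\mathcal{H})$. Then: (1) $J(\mathcal{H})^{(rh-h)} \subset J(\mathcal{H})^r$ for all integers $r \geq \chi(\mathcal{H})$. (2) $\rho_a(J(\mathcal{H})) \leq h - \frac{1}{\chi(\mathcal{H})}$. (3) For any subhypergraph $\mathcal{H}'$ of $\mathcal{H}$, $\rho(J(\mathcal{H}')) \leq \rho(J(\mathcal{H}))$ and $\rho_a(J(\mathcal{H}')) \leq \rho_a(J(\mathcal{H}))$.
   Context: A hypergraph $\mathcal{H}$ is a pair $(V(\mathcal{H}),E(\mathcal{H}))$ with $V(\mathcal{H})$ a finite set of vertices and $E(\mathcal{H})$ a non-empty set of subsets of $V(\mathcal{H})$ (edges) such that $|e|\ge 2$ for every edge $e$ and no edge is contained in a different edge. A hypergraph $\mathcal{H}'$ is a subhypergraph of $\mathcal{H}$ if $V(\mathcal{H}')\subseteq V(\mathcal{H})$, $E(\mathcal{H}')\subseteq E(\mathcal{H})$, and an edge $e\in E(\mathcal{H})$ belongs to $E(\mathcal{H}')$ if and only if $e\subseteq V(\mathcal{H}')$. A vertex cover of $\mathcal{H}$ is a subset $\Gamma\subseteq V(\mathcal{H})$ with $\Gamma\cap e\ne\emptyset$ for all $e\in E(\mathcal{H})$. The chromatic number $\chi(\mathcal{H})$ is the least number of colors needed to color the vertices so that no edge has all its vertices of the same color. If $V(\mathcal{H})=\{x_1,\dots,x_n\}$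 and $\mathbb{K}$ is a field, the cover ideal $J(\mathcal{H})\subset \mathbb{K}[x_1,\dots,x_n]$ is generated by the monomials $\prod_{x\in\Gamma}x$, $\Gamma$ a vertex cover of $\mathcal{H}$; equivalently $J(\mathcal{H})=\bigcap_{e\in E(\mathcal{H})}(x : x\in e)$. The big height of an ideal is the maximum of the heights of its associated primes. For an ideal $I$ in a Noetherian ring $R$, the symbolic power is $I^{(s)}=\bigcap_{P\in\mathrm{Ass}(I)}(I^sR_P\cap R)$. The resurgence and asymptotic resurgence are $\rho(I)=\sup\{s/t : s,t\in\mathbb{N},\ I^{(s)}\not\subset I^t\}$ and $\rho_a(I)=\sup\{s/t : s,t\in\mathbb{N},\ I^{(sr)}\not\subset I^{tr}\text{ for all } r\gg0\}$, where $\mathbb{N}$ denotes the positive integers. *)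

(* Defs.v *)
From HB Require Import structures.
From mathcomp Require Import all_boot all_order all_algebra.
From mathcomp Require Import mpoly.
From mathcomp Require Import classical_sets reals ereal.

Set Implicit Arguments.
Unset Strict Implicit.
Unset Printing Implicit Defensive.

Import GRing.Theory.

Local Open Scope ring_scope.
Local Open Scope classical_set_scope.

(* Hypergraphs. The ambient finType T only serves as a reservoir of names, so *)
(* that a hypergraph and its subhypergraphs live over the same T.             *)

Record hypergraph (T : finType) := Hypergraph {
  hvert : {set T};
  hedge : {set {set T}};
  hedge_neq0 : hedge != finset.set0;
  hedge_sub : forall e, e \in hedge -> e \subset hvert;
  hedge_card : forall e, e \in hedge -> (2 <= #|e|)%N;
  hedge_antichain : forall e f, e \in hedge -> f \in hedge -> e \subset f -> e = f
}.

Definition subhypergraph (T : finType) (H' H : hypergraph T) : Prop :=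
  [/\ hvert H' \subset hvert H,
      hedge H' \subset hedge H &
      forall e, e \in hedge H -> (e \in hedge H') = (e \subset hvert H')].

Definition vertex_cover (T : finType) (H : hypergraph T) (G : {set T}) : bool :=
  (G \subset hvert H) && [forall e in hedge H, (G :&: e)%SET != finset.set0].

(* Colourings of all of T are used: as every edge is a nonempty subset of     *)
(* hvert H, the colours outside hvert H are irrelevant.                       *)
Definition colorable (T : finType) (H : hypergraph T) (k : nat) : bool :=
  [exists f : {ffun T -> 'I_k},
    [forall e in hedge H, ~~ [exists a, [forall x in e, f x == a]]]].

Lemma colorable_exists (T : finType) (H : hypergraph T) :
  exists k, colorable H k.
Proof.
exists #|T|; apply/existsP; exists [ffun x => enum_rank x].
apply/forall_inP => e eH; apply/existsP => -[a /forall_inP ea].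
have /card_gt1P[x [y [xe ye]]] := hedge_card eH.
move/eqP: (ea x xe); move/eqP: (ea y ye); rewrite !ffunE => <- /enum_rank_inj ->.
by rewrite eqxx.
Qed.

Definition chromatic_number (T : finType) (H : hypergraph T) : nat :=
  ex_minn (colorable_exists H).

(* I is an ideal of the subring A of S; A = setT gives the ideals of S. *)
Definition ideal_in (S : comNzRingType) (A I : set S) : Prop :=
  [/\ I `<=` A, I 0, forall x y, I x -> I y -> I (x + y) &
      forall a x, A a -> I x -> I (a * x)].

Section CommutativeAlgebra.
Variable R : idomainType.
Implicit Types (I J P : set R).

Definition ideal I : Prop := ideal_in setT I.

Definition ideal_gen (G : set R) : set R := smallest ideal G.

Definition ideal_mul I J : set R := ideal_gen [set x * y | x in I & y in J].

Definition ideal_pow I (n : nat) : set R := iter n (ideal_mul I) setT.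

Definition prime_ideal P : Prop :=
  [/\ ideal P, ~ P 1 & forall x y, P (x * y) -> P x \/ P y].

Definition Ass I : set (set R) :=
  [set P | prime_ideal P /\ exists x, P = [set a | I (a * x)]].

Definition prime_chain P (n : nat) : Prop :=
  exists c : nat -> set R,
    [/\ c n = P, forall i, (i <= n)%N -> prime_ideal (c i) &
        forall i, (i < n)%N -> c i `<` c i.+1].

Definition height P (k : nat) : Prop :=
  prime_chain P k /\ forall n, prime_chain P n -> (n <= k)%N.

Definition big_height I (h : nat) : Prop :=
  (exists2 P, Ass I P & height P h) /\
  (forall P, Ass I P -> exists2 k, height P k & (k <= h)%N).

(* R being a domain, R_P is the subring {a / u : u \notin P} of Frac(R). *)
Definition localization P : set {fraction R} :=
  [set tofrac a / tofrac u | a in setT & u in ~` P].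

Definition loc_extend P I : set {fraction R} :=
  smallest (ideal_in (localization P)) (@tofrac R @` I).

Definition symbolic_power I (s : nat) : set R :=
  \bigcap_(P in Ass I) (@tofrac R @^-1` loc_extend P (ideal_pow I s)).

Variable F : realType.
Local Open Scope ereal_scope.

Definition resurgence I : \bar F :=
  ereal_sup [set x | exists s t : nat,
    [/\ (0 < s)%N, (0 < t)%N,
        ~ (symbolic_power I s `<=` ideal_pow I t) &
        x = (s%:R / t%:R)%:E]].

Definition asymptotic_resurgence I : \bar F :=
  ereal_sup [set x | exists s t : nat,
    [/\ (0 < s)%N, (0 < t)%N,
        exists N : nat, forall r : nat, (N <= r)%N ->
          ~ (symbolic_power I (s * r) `<=` ideal_pow I (t * r)) &
        x = (s%:R / t%:R)%:E]].

End CommutativeAlgebra.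

(* The polynomial ring of H has one variable per vertex: 'X_i stands for the  *)
(* vertex enum_val i of hvert H.                                              *)
Definition cover_ideal (K : fieldType) (T : finType) (H : hypergraph T) :
    set {mpoly K[#|hvert H|]} :=
  ideal_gen [set m | exists2 G : {set T}, vertex_cover H G &
    m = \prod_(i < #|hvert H| | enum_val i \in G) 'X_i].

Arguments cover_ideal K {T} H _.

(* Main.v *)
Require Import Defs.
From mathcomp Require Import all_boot all_order all_algebra.
From mathcomp Require Import mpoly.
From mathcomp Require Import classical_sets reals ereal.
From mathcomp Require Import boolp zify ring.

Set Implicit Arguments.
Unset Strict Implicit.
Unset Printing Implicit Defensive.

Import Order.TTheory GRing.Theory Num.Theory.

Local Open Scope ring_scope.
Local Open Scope classical_set_scope.

(** Everything reduces to exponent vectors. The cover ideal J is the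
    intersection of the primes P_e generated by the variables of an edge e, so
    it is spanned by the monomials whose weight wt e (the degree in the
    variables of e) is positive for every edge e. Its power J^t is spanned by
    the products of t such monomials (cover_ideal_pow), and its symbolic power
    J^(s) by the monomials of weight at least s on every edge
    (symbolic_power_cover). The latter needs two facts. The P_e are exactly
    the associated primes, because edges are pairwise incomparable; and an
    element u outside P_e has order 0 along e, so u * f and f have the same
    order there (weight_ideal_cancel). Finally
    #|e| <= h for the big height h, by the chain of primes generated by the
    initial segments of e (big_height_edge).

    For the containment of J^(rh - h) in J^r, let a be an exponent vector of weight at least (r - 1) h on each
    edge. As an edge has at most h vertices, either some vertex of it has
    a >= r, or a is constantly r - 1 on it. Fix a proper colouring with at
    most r colours, and for each j < r let C_j consist of the vertices with
    a >= r and of those with a = r - 1 whose colour is not j. No edge is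
    monochromatic, so C_j is a cover; and a vertex with a = r - 1 is left out
    of one of the r sets, so the C_j together use each vertex x at most a(x)
    times (splits_chromatic).

    For the asymptotic bound, let chi be the chromatic number. Rounding a / n
    down and applying the preceding argument with r = chi gives J^(n (chi h - 1)) in J^(n chi) for
    all n (splits_chromatic_mul); if s/t > h - 1/chi then
    s chi >= t (chi h - 1), hence J^(s r) is in J^(t r) for every multiple r
    of chi.

    For a subhypergraph H', extend an exponent vector on V(H') by the value s at the other
    vertices. Edges of H that are not edges of H' leave V(H'), so the weights
    stay at least s, while a decomposition into covers of H restricts to one
    into covers of H'. Thus a containment for H implies the same containment
    for H' (symbolic_subhypergraph), and the suprema are taken over a smaller
    set for H'. *)

(** * Ideals, primes and localization *)

Section Ideals.
Variable R : idomainType.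
Implicit Types (I P G : set R).

Lemma ideal_gen_ideal G : ideal (ideal_gen G).
Proof.
split=> //.
- by move=> A [[_ A0 _ _] _].
- by move=> x y Ix Iy A [idA GA]; case: (idA) => _ _ AD _; apply: AD; [apply: Ix|apply: Iy].
- by move=> a x _ Ix A [idA GA]; case: (idA) => _ _ _ AM; apply: AM => //; apply: Ix.
Qed.

Lemma ideal_sum I (A : eqType) (s : seq A) (f : A -> R) :
  ideal I -> (forall x, x \in s -> I (f x)) -> I (\sum_(x <- s) f x).
Proof.
move=> [_ I0 ID _] If; rewrite big_seq; apply: big_ind => //.
Qed.

Lemma prime_ideal_exp P x k : prime_ideal P -> P (x ^+ k) -> P x.
Proof.
move=> [_ P1 PM]; elim: k => [|k IH]; first by rewrite expr0.
by rewrite exprS => /PM[].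
Qed.

Lemma prime_ideal_prod P (A : finType) (Q : pred A) (f : A -> R) :
  prime_ideal P -> P (\prod_(i | Q i) f i) -> exists2 i, Q i & P (f i).
Proof.
move=> [_ P1 PM]; apply: (big_ind (fun x => P x -> exists2 i, Q i & P (f i))) => //.
- by move=> x y IHx IHy /PM[].
- by move=> i Qi Pi; exists i.
Qed.

(** The fractions a / u with a in I and u outside P already form an ideal of the
    localization, so clearing denominators decides membership. *)
Lemma loc_extendP P I f : prime_ideal P -> ideal I ->
  loc_extend P I (tofrac f) <-> exists2 u, ~ P u & I (u * f).
Proof.
move=> [[_ P0 PD _] P1 PM] [_ I0 ID IM].
have nz u : ~ P u -> tofrac u != 0.
  by rewrite tofrac_eq0; move=> Pu; apply/eqP => u0; apply: Pu; rewrite u0.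
split; last first.
  move=> [u Pu Iuf] A [[_ _ _ AM] IA].
  have -> : tofrac f = (tofrac 1 / tofrac u) * tofrac (u * f).
    by rewrite tofrac1 tofracM mul1r mulKf ?nz.
  by apply: AM; [exists 1 => //; exists u | apply: IA; exists (u * f)].
pose B := [set z : {fraction R} | exists a u, [/\ I a, ~ P u & z = tofrac a / tofrac u]].
have idB : ideal_in (localization P) B.
  split.
  - by move=> z [a [u [Ia Pu ->]]]; exists a => //; exists u.
  - by exists 0, 1; split => //; rewrite tofrac0 mul0r.
  - move=> _ _ [a [u [Ia Pu ->]]] [b [v [Ib Pv ->]]].
    exists (a * v + b * u), (u * v); split.
    + by apply: ID; rewrite mulrC; apply: IM.
    + by move=> /PM[].
    + by rewrite tofracD !tofracM addf_div ?nz.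
  - move=> _ _ [a _ [u Pu <-]] [b [v [Ib Pv ->]]].
    exists (a * b), (u * v); split; [exact: IM|by move=> /PM[]|].
    by rewrite !tofracM mulf_div.
have IB : (@tofrac R) @` I `<=` B.
  by move=> _ [a Ia <-]; exists a, 1; split => //; rewrite tofrac1 divr1.
move=> /(_ B (conj idB IB)) [a [u [Ia Pu e]]]; exists u => //.
have /eqP : tofrac (u * f) = tofrac a by rewrite tofracM e mulrC divfK ?nz.
by rewrite tofrac_eq => /eqP ->.
Qed.

End Ideals.

(** * Monomial ideals *)

Section MonomialIdeals.
Variables (K : fieldType) (n : nat).
Implicit Types (U V : 'X_{1..n} -> Prop) (m : 'X_{1..n}) (p q : {mpoly K[n]}).

Definition upclosed U := forall m m', U m -> U (m + m')%MM.

Lemma upclosed_le U m m' : upclosed U -> (m <= m')%MM -> U m -> U m'.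
Proof. by move=> upU le Um; rewrite -(submK le) addmC; apply: upU. Qed.

(** The span of the monomials satisfying U; an ideal when U is closed under
    multiples. *)
Definition monomial_ideal U : set {mpoly K[n]} :=
  [set p | forall m, m \in msupp p -> U m].

Lemma monomial_idealX U m : monomial_ideal U 'X_[m] <-> U m.
Proof.
split; first by apply; rewrite msuppX inE.
by move=> Um k; rewrite msuppX inE => /eqP ->.
Qed.

Lemma monomial_ideal_mulX U p m :
  monomial_ideal U ('X_[m] * p) <->
  monomial_ideal (fun k => U (m + k)%MM) p.
Proof.
rewrite mulrC; split=> Up k.
  by move=> kp; apply: Up; rewrite (perm_mem (msuppMX _ _)) map_f.
by rewrite (perm_mem (msuppMX _ _)) => /mapP[k' /Up ? ->].
Qed.

Lemma ideal_monomial U : upclosed U -> ideal (monomial_ideal U).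
Proof.
move=> upU; split=> //.
- by move=> m; rewrite msupp0.
- by move=> p q Up Uq m /msuppD_le; rewrite mem_cat => /orP[/Up|/Uq].
- move=> p q _ Uq m /msuppM_le /allpairsP[[a b] /= [_ /Uq Ub ->]].
  by rewrite addmC; apply: upU.
Qed.

Lemma monomial_ideal_sub U I :
  ideal I -> (forall m, U m -> I 'X_[m]) -> monomial_ideal U `<=` I.
Proof.
move=> idI UI p Up; rewrite [p]mpolyE; apply: ideal_sum => // m /Up Um.
by rewrite -mul_mpolyC; case: idI => _ _ _; apply => //; apply: UI.
Qed.

Lemma ideal_gen_monomial U G : upclosed U -> G `<=` monomial_ideal U ->
  (forall m, U m -> exists2 k, G 'X_[k] & (k <= m)%MM) ->
  ideal_gen G = monomial_ideal U.
Proof.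
move=> upU GU UG; apply/seteqP; split.
  by apply: smallest_sub => //; apply: ideal_monomial.
apply: monomial_ideal_sub (ideal_gen_ideal _) _ => m /UG[k Gk km].
rewrite -(submK km) mpolyXD; case: (ideal_gen_ideal G) => _ _ _; apply => //.
exact: sub_gen_smallest.
Qed.

(** When U is the exponent set of a monomial ideal I, this is the one of I^t. *)
Fixpoint splits U t m : Prop :=
  if t is t'.+1 then exists a b, [/\ U a, splits U t' b & m = (a + b)%MM]
  else True.

Lemma upclosed_splits U t : upclosed U -> upclosed (splits U t).
Proof.
move=> upU; case: t => [//|t] m m' /= [a [b [Ua Ub ->]]].
exists (a + m')%MM, b; split; [exact: upU | by [] |].
by rewrite -!addmA (addmC b).
Qed.

Lemma ideal_pow_monomial U t : upclosed U ->
  ideal_pow (monomial_ideal U) t = monomial_ideal (splits U t).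
Proof.
move=> upU; elim: t => [|t]; first by apply/seteqP; split.
rewrite /ideal_pow iterS => ->.
apply: ideal_gen_monomial; first exact: (@upclosed_splits U t.+1).
  move=> _ [x Ux [y Uy <-]] m /msuppM_le /allpairsP[[a b] /= [/Ux Ua /Uy Ub ->]].
  by exists a, b.
move=> _ [a [b [Ua Ub ->]]]; exists (a + b)%MM; last exact: lepm_refl.
exists 'X_[a]; first exact/monomial_idealX.
by exists 'X_[b]; [exact/monomial_idealX | rewrite mpolyXD].
Qed.

Lemma splits_family U t (c : nat -> 'X_{1..n}) m : upclosed U ->
  (forall j, (j < t)%N -> U (c j)) ->
  (forall i, (\sum_(j < t) c j i <= m i)%N) -> splits U t m.
Proof.
move=> upU; elim: t m => [//|t IH] m Uc le.
have ct : (c t <= m)%MM.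
  by apply/mnm_lepP => i; apply: leq_trans (le i); rewrite big_ord_recr leq_addl.
exists (c t), (m - c t)%MM; split; first exact: Uc.
  apply: IH => [j jt|i]; first by apply: Uc; apply: ltnW.
  by rewrite mnmBE; have := le i; rewrite big_ord_recr /=; lia.
by rewrite addmC submK.
Qed.

(** For an upward closed U the surplus of m over the sum of the t parts can be
    absorbed by any part, so domination may replace equality. *)
Lemma splitsP U t m : upclosed U -> splits U t m <->
  exists2 c : nat -> 'X_{1..n}, (forall j, (j < t)%N -> U (c j)) &
    forall i, (\sum_(j < t) c j i <= m i)%N.
Proof.
move=> upU; split; last by move=> [c]; apply: splits_family.
elim: t m => [|t IH] m; first by exists (fun=> m) => // i; rewrite big_ord0.
move=> [a [b [Ua /IH[c Uc le] ->]]].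
exists (fun j => if j == t then a else c j) => [j|i].
  by case: eqP => // /eqP jt; rewrite ltnS leq_eqVlt (negPf jt) => /Uc.
rewrite big_ord_recr /= eqxx mnmDE addnC leq_add2l.
by under eq_bigr => j _ do rewrite ltn_eqF //.
Qed.

(** Repeating a splitting of m cyclically k times splits every vector above k * m. *)
Lemma splits_mul U t k m m' : upclosed U -> splits U t m ->
  (forall i, (k * m i <= m' i)%N) -> splits U (k * t) m'.
Proof.
move=> upU /(splitsP _ _ upU)[c Uc le] lem'.
case: t c Uc le => [|t] c Uc le; first by rewrite muln0.
apply/splitsP => //; exists (fun j => c (j %% t.+1)%N) => [j _|i].
  by apply: Uc; rewrite ltn_mod.
apply: leq_trans (lem' i); apply: leq_trans (leq_mul (leqnn k) (le i)).
elim: k {lem'} => [|k IH]; first by rewrite mul0n big_ord0.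
rewrite mulSn big_split_ord /= mulSn leq_add //.
  by apply: leq_sum => j _; rewrite modn_small.
by apply: leq_trans IH; apply: leq_sum => j _; rewrite modnDl.
Qed.

(** An additive weight on monomials is the order of vanishing along the ideal of
    elements of positive weight; this valuation property is what lets
    denominators be cancelled. *)
Section Weight.
Variable w : 'X_{1..n} -> nat.
Hypothesis wD : forall m m', w (m + m')%MM = (w m + w m')%N.

Lemma upclosed_weight k : upclosed (fun m => (k <= w m)%N).
Proof. by move=> m m' km; apply: leq_trans km _; rewrite wD leq_addr. Qed.

Lemma splits_weight U s m : (forall k, U k -> (0 < w k)%N) ->
  splits U s m -> (s <= w m)%N.
Proof.
move=> Uw; elim: s m => [//|s IH] m [a [b [/Uw wa /IH wb ->]]].
by rewrite wD -add1n leq_add.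
Qed.

Let Q k := monomial_ideal (fun m => (k <= w m)%N).

Let component (A : pred 'X_{1..n}) p : {mpoly K[n]} :=
  \sum_(m <- msupp p | A m) p@_m *: 'X_[m].

Let componentP A p m : m \in msupp (component A p) -> A m && (m \in msupp p).
Proof.
move=> /msupp_sum_le /flatten_mapP[k]; rewrite mem_filter => Ak.
by move=> /msuppZ_le; rewrite msuppX inE => /eqP ->.
Qed.

Let componentD A p : p = component A p + component (predC A) p.
Proof. by rewrite {1}[p]mpolyE (bigID A). Qed.

Let weight_idealM j k p q : Q j p -> Q k q -> Q (j + k) (p * q).
Proof.
move=> Qp Qq m /msuppM_le /allpairsP[[a b] /= [/Qp ja /Qq kb ->]].
by rewrite wD leq_add.
Qed.

(** Multiplication by u raises no order: if p0 and u0 denote the components of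
    lowest possible weight, k and 0, then u0 * p0 is the component of weight k
    of u * p, which vanishes. The polynomial ring being a domain and u0 being
    nonzero, p0 vanishes. *)
Let weight_ideal_step k u p : ~ Q 1 u -> Q k p -> Q k.+1 (u * p) -> Q k.+1 p.
Proof.
move=> Qu Qp Qup.
have [Q0 QD QM] : [/\ Q k.+1 0, forall x y, Q k.+1 x -> Q k.+1 y -> Q k.+1 (x + y) &
    forall x y, Q k.+1 y -> Q k.+1 (x * y)].
  have [_ I0 ID IM] := ideal_monomial (@upclosed_weight k.+1).
  by split => // x y; apply: IM.
pose A : pred 'X_{1..n} := fun m => w m == k.
pose B : pred 'X_{1..n} := fun m => w m == 0%N.
have Qp1 : Q k.+1 (component (predC A) p).
  move=> m /componentP/andP[/= mA /Qp]; rewrite leq_eqVlt eq_sym.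
  by rewrite -/(A m) (negPf mA).
have Qu1 : Q 1 (component (predC B) u).
  by move=> m /componentP/andP[/= mB _]; rewrite lt0n.
have Qp0 : Q k (component A p) by move=> m /componentP/andP[_ /Qp].
have Qu0p0 : Q k.+1 (component B u * component A p).
  have -> : component B u * component A p = u * p
      + (- component A p * component (predC B) u + - u * component (predC A) p).
    have := componentD A p; have := componentD B u.
    move: (component B u) (component A p) (component (predC B) u).
    by move: (component (predC A) p) => y' x y x' -> ->; ring.
  apply: (QD) => //; apply: (QD); last exact: QM.
  rewrite -[k.+1]addn1; apply: weight_idealM => //.
  by move=> m; rewrite (perm_mem (msuppN _)) => /Qp0.
have : component B u * component A p = 0.
  apply/eqP; rewrite -msupp_eq0; case E: (msupp _) => [//|m s].
  have mE : m \in msupp (component B u * component A p) by rewrite E mem_head.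
  have := Qu0p0 m mE.
  have /allpairsP[[a b] /= [/componentP/andP[/eqP wa _] /componentP/andP[/eqP wb _] ->]] :=
    msuppM_le mE.
  by rewrite wD wa wb ltnn.
move=> /eqP; rewrite mulf_eq0 => /orP[/eqP u0|/eqP p0]; last first.
  by rewrite (componentD A p) p0 add0r.
by case: Qu; rewrite (componentD B u) u0 add0r.
Qed.

Lemma weight_ideal_cancel k u p : ~ Q 1 u -> Q k (u * p) -> Q k p.
Proof.
move=> Qu; elim: k => [|k IH] Qup; first by [].
have Qk : Q k p by apply: IH => m /Qup /ltnW.
exact: weight_ideal_step Qk Qup.
Qed.

Lemma weight_ideal_prime : w 0%MM = 0%N -> prime_ideal (Q 1).
Proof.
move=> w0; split; first exact/ideal_monomial/upclosed_weight.
  by move=> /(_ 0%MM); rewrite msupp1 mem_head w0 => /(_ isT).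
move=> p q Qpq; case: (EM (Q 1 p)) => Qp; [by left | right].
exact: weight_ideal_cancel Qp Qpq.
Qed.

End Weight.
End MonomialIdeals.

Arguments monomial_ideal K {n} U _.

(** * Weights of exponent vectors on sets of vertices *)

Section Weights.
Variables (T : finType) (V : {set T}).
Implicit Types (S e : {set T}) (m : 'X_{1..#|V|}).

Definition wt S m := (\sum_(i < #|V| | enum_val i \in S) m i)%N.

Lemma wtD S m m' : wt S (m + m')%MM = (wt S m + wt S m')%N.
Proof. by rewrite /wt -big_split; apply: eq_bigr => i _; rewrite mnmDE. Qed.

Lemma wt0 S : wt S 0%MM = 0%N.
Proof. by rewrite /wt big1 // => i _; rewrite mnm0E. Qed.

Lemma wt_mnm1 S (i : 'I_#|V|) : enum_val i \in S -> wt S U_(i)%MM = 1%N.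
Proof.
move=> iS; rewrite /wt (bigD1 i) //= mnm1E eqxx big1 // => j /andP[_ ji].
by rewrite mnm1E eq_sym (negPf ji).
Qed.

Lemma wt_gt0P S m :
  reflect (exists2 i, enum_val i \in S & (0 < m i)%N) (0 < wt S m)%N.
Proof.
rewrite lt0n /wt sum_nat_eq0 negb_forall_in; apply: (iffP exists_inP).
  by move=> [i iS mi]; exists i => //; rewrite lt0n.
by move=> [i iS mi]; exists i => //; rewrite -lt0n.
Qed.

Definition mnm_of (a : T -> nat) : 'X_{1..#|V|} := [multinom a (enum_val i) | i < #|V|].

Lemma mnm_ofE a i : mnm_of a i = a (enum_val i).
Proof. exact: mnmE. Qed.

Lemma wt_mnm_of S a : S \subset V -> wt S (mnm_of a) = (\sum_(x in S) a x)%N.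
Proof.
move=> SV; rewrite /wt (eq_bigr (fun i => a (enum_val i))); last first.
  by move=> i _; rewrite mnmE.
rewrite -(big_enum_val_cond (fun x => x \in S) a); apply: eq_bigl => x.
by apply: andb_idl => /(fintype.subsetP SV).
Qed.

(** Lets weights on subsets of V be computed as sums over vertices instead of
    indices of variables. *)
Lemma mnm_of_surj m : exists a, m = mnm_of a.
Proof.
exists (fun x => \sum_(i < #|V| | enum_val i == x) m i)%N.
apply/mnmP => i; rewrite mnmE (big_pred1 i) // => j.
by rewrite (inj_eq enum_val_inj).
Qed.

Lemma enum_val_surj x : x \in V -> exists i : 'I_#|V|, enum_val i = x.
Proof. by move=> xV; exists (enum_rank_in xV x); rewrite enum_rankK_in. Qed.

End Weights.

(** * Ordinary and symbolic powers of the cover ideal *)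

Section CoverIdeal.
Variables (K : fieldType) (T : finType) (H : hypergraph T).
Implicit Types (e S : {set T}) (m : 'X_{1..#|hvert H|}).

Definition covers m : Prop := forall e, e \in hedge H -> (0 < wt e m)%N.

Lemma upclosed_covers : upclosed covers.
Proof. by move=> m m' cm e eH; rewrite wtD addn_gt0 cm. Qed.

Lemma cover_idealE : cover_ideal K H = monomial_ideal K covers.
Proof.
have prodX (G : {set T}) : \prod_(i < #|hvert H| | enum_val i \in G) 'X_i
    = 'X_[mnm_of (hvert H) (fun x => x \in G)] :> {mpoly K[#|hvert H|]}.
  rewrite mpolyXE_id big_mkcond; apply: eq_bigr => i _; rewrite mnmE.
  by case: (_ \in G).
apply: ideal_gen_monomial; first exact: upclosed_covers.
  move=> _ [G /andP[GV /forall_inP Ge] ->]; rewrite prodX.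
  apply/monomial_idealX => e eH; apply/wt_gt0P.
  have /set0Pn[x] := Ge e eH; rewrite inE => /andP[xG xe].
  have [i ix] := enum_val_surj (fintype.subsetP GV x xG).
  by exists i; rewrite ?mnmE ix ?xG.
move=> m cm; pose G := [set enum_val i | i : 'I_#|hvert H| & (0 < m i)%N]%SET.
exists (mnm_of (hvert H) (fun x => x \in G)).
  exists G; rewrite ?prodX //; apply/andP; split.
    by apply/fintype.subsetP => _ /imsetP[i _ ->]; apply: enum_valP.
  apply/forall_inP => e /cm /wt_gt0P[i ie mi]; apply/set0Pn; exists (enum_val i).
  by rewrite inE ie andbT; apply/imsetP; exists i; rewrite ?inE.
apply/mnm_lepP => i; rewrite mnmE; case: imsetP => //= -[j].
by rewrite inE => mj /enum_val_inj ->.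
Qed.

Lemma cover_ideal_pow t :
  ideal_pow (cover_ideal K H) t = monomial_ideal K (splits covers t).
Proof. by rewrite cover_idealE ideal_pow_monomial //; apply: upclosed_covers. Qed.

(** The ideal generated by the variables of the vertices in e. It is also used
    when e is not an edge, for the chain of primes in big_height_edge. *)
Definition var_ideal e : set {mpoly K[#|hvert H|]} :=
  monomial_ideal K (fun m => (1 <= wt e m)%N).

Lemma var_ideal_prime S : prime_ideal (var_ideal S).
Proof. by apply: weight_ideal_prime; [apply: wtD | apply: wt0]. Qed.

Lemma cover_ideal_capE f :
  cover_ideal K H f <-> forall e, e \in hedge H -> var_ideal e f.
Proof.
rewrite cover_idealE; split; first by move=> Jf e eH m /Jf; apply.
by move=> ef m mf e eH; apply: ef.
Qed.

(** As edges are pairwise incomparable, the complement of an edge meets every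
    other edge; adding one vertex of the edge makes it a cover. *)
Lemma edge_meets_setC e e' : e \in hedge H -> e' \in hedge H -> e' != e ->
  exists2 i : 'I_#|hvert H|, enum_val i \in e' & enum_val i \notin e.
Proof.
move=> eH e'H /eqP ne.
have /fintype.subsetPn[x xe' xe] : ~~ (e' \subset e).
  by apply/negP => /(hedge_antichain e'H eH).
have [i ix] := enum_val_surj (fintype.subsetP (hedge_sub e'H) x xe').
by exists i; rewrite ix.
Qed.

(** The annihilator modulo J of the product of the variables outside e is the
    ideal of e, since that product already meets all the other edges. *)
Lemma var_ideal_Ass e : e \in hedge H -> Ass (cover_ideal K H) (var_ideal e).
Proof.
move=> eH; split; first exact: var_ideal_prime.
exists 'X_[mnm_of (hvert H) (fun x => x \notin e)].
rewrite cover_idealE; apply/seteqP; split=> f /=; rewrite mulrC => ef.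
  apply/monomial_ideal_mulX => m /ef em e' e'H; rewrite wtD addn_gt0.
  have [->|/(edge_meets_setC eH e'H)[i ie' ie]] := eqVneq e' e.
    by rewrite em orbT.
  by apply/orP; left; apply/wt_gt0P; exists i; rewrite ?mnm_ofE ?ie.
move/monomial_ideal_mulX: ef => ef m /ef /(_ e eH).
rewrite wtD wt_mnm_of ?(hedge_sub eH) // big1 // => x xe.
by rewrite xe.
Qed.

(** Let P = (J : x), and choose an edge e with x not in its ideal. A variable in P
    lies in e because the ideal of e is prime. Conversely, if a variable of e were
    missing from P, the variables outside P would form a cover, whose product
    is in J and hence in P, contradicting the primality of P. *)
Lemma Ass_edge P : Ass (cover_ideal K H) P ->
  exists2 e, e \in hedge H & forall i, P 'X_i <-> enum_val i \in e.
Proof.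
move=> [primeP [x Px]]; have [idP P1 PM] := primeP.
have PE a : P a <-> cover_ideal K H (a * x) by rewrite Px.
have [e eH xe] : exists2 e, e \in hedge H & ~ var_ideal e x.
  apply: contrapT => nex; apply/P1/PE; rewrite mul1r; apply/cover_ideal_capE.
  by move=> e eH; apply: contrapT => xe; apply: nex; exists e.
have Pe i : P 'X_i -> enum_val i \in e.
  move=> /PE/cover_ideal_capE/(_ e eH) exi.
  have [_ _ /(_ _ _ exi)[/monomial_idealX/wt_gt0P[j je]|//]] := var_ideal_prime e.
  by rewrite mnm1E lt0b => /eqP ->.
exists e => // i; split=> [/Pe //|ie].
apply: contrapT => nPi.
pose y := \prod_(j < #|hvert H| | `[< ~ P 'X_j >]) ('X_j : {mpoly K[#|hvert H|]}).
suff /(prime_ideal_prod primeP)[j /asboolP] : P y by [].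
suff Jy : cover_ideal K H y.
  apply/PE/cover_ideal_capE => e' e'H; have [[_ _ _ IM] _ _] := var_ideal_prime e'.
  by rewrite mulrC; apply: IM => //; move/cover_ideal_capE: Jy; apply.
apply/cover_ideal_capE => e' e'H.
have [j je' nPj] : exists2 j : 'I_#|hvert H|, enum_val j \in e' & ~ P 'X_j.
  have [->|/(edge_meets_setC eH e'H)[j je' je]] := eqVneq e' e; first by exists i.
  by exists j => // /Pe; apply/negP.
rewrite /y (bigD1 j) /=; last exact/asboolP.
have [[_ _ _ IM] _ _] := var_ideal_prime e'; rewrite mulrC; apply: IM => //.
by apply/monomial_idealX/wt_gt0P; exists j; rewrite ?mnm1E ?eqxx.
Qed.

(** Each of the s units of weight on e, together with the complement of e, makes
    a cover. Hence the s-th power of the product of the variables outside e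
    is a denominator that brings J^(s) into J^s at the prime of e. *)
Lemma splits_setC e s m : e \in hedge H -> (s <= wt e m)%N ->
  splits covers s (mnm_of (hvert H) (fun x => x \notin e) *+ s + m)%MM.
Proof.
move=> eH; set c := mnm_of _ _.
elim: s m => [//|s IH] m sm.
have /wt_gt0P[i ie mi] : (0 < wt e m)%N by exact: leq_trans sm.
have Um : (U_(i) <= m)%MM by rewrite lep1mP -lt0n.
exists (c + U_(i))%MM, (c *+ s + (m - U_(i)))%MM; split.
- move=> e' e'H; rewrite wtD addn_gt0.
  have [->|/(edge_meets_setC eH e'H)[j je' je]] := eqVneq e' e.
    by rewrite wt_mnm1 // orbT.
  by apply/orP; left; apply/wt_gt0P; exists j; rewrite ?mnm_ofE ?je.
- by apply: IH; move: sm; rewrite -{1}(submK Um) wtD wt_mnm1 // addn1.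
- rewrite mulmS -{1}(submK Um); apply/mnmP => j; rewrite !mnmDE [X in (_ + X)%N = _]addnC.
  by rewrite addnACA.
Qed.

Lemma symbolic_power_cover s :
  symbolic_power (cover_ideal K H) s =
  monomial_ideal K (fun m => forall e, e \in hedge H -> (s <= wt e m)%N).
Proof.
have idJ : ideal (ideal_pow (cover_ideal K H) s).
  by rewrite cover_ideal_pow; apply/ideal_monomial/upclosed_splits/upclosed_covers.
apply/seteqP; split=> f /=.
  move=> sf m mf e eH.
  have /(loc_extendP _ (var_ideal_prime e) idJ)[u eu] := sf _ (var_ideal_Ass eH).
  rewrite cover_ideal_pow => uf.
  suff : monomial_ideal K (fun m => (s <= wt e m)%N) f by apply.
  apply: weight_ideal_cancel eu _ => [|k /uf]; first exact: wtD.
  by apply: splits_weight => [|k' /(_ e eH)//]; apply: wtD.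
move=> wf P AP; have [primeP _] := AP; apply/(loc_extendP _ primeP idJ).
have [e eH Pe] := Ass_edge AP.
pose c := mnm_of (hvert H) (fun x => x \notin e).
exists ('X_[c] ^+ s).
  move=> /(prime_ideal_exp primeP); rewrite mpolyXE_id.
  move=> /(prime_ideal_prod primeP)[i _ Pi].
  have ie : enum_val i \in e by apply/Pe/(prime_ideal_exp primeP Pi).
  by move: Pi; rewrite mnm_ofE ie expr0; case: primeP.
rewrite cover_ideal_pow mpolyXn; apply/monomial_ideal_mulX => m /wf /(_ e eH).
exact: splits_setC.
Qed.

(** The primes generated by the first i vertices of e, for 0 <= i <= #|e|, form
    a chain of length #|e| ending at the associated prime of e. *)
Lemma big_height_edge h e : big_height (cover_ideal K H) h ->
  e \in hedge H -> (#|e| <= h)%N.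
Proof.
move=> [_ hP] eH; have [k [_ hk] kh] := hP _ (var_ideal_Ass eH).
apply: leq_trans kh; apply: hk.
pose c i := var_ideal [set x in take i (enum e)]%SET.
exists c; split=> [|i _|i ie]; first 2 last.
- have [x0 _] : exists x0, x0 \in e by apply/card_gt0P; apply: leq_ltn_trans ie.
  have sz : (i < size (enum e))%N by rewrite -cardE.
  have takeS := take_nth x0 sz.
  split.
    move=> f cf m /cf /wt_gt0P[j]; rewrite inE => je mj; apply/wt_gt0P.
    by exists j => //; rewrite inE takeS mem_rcons inE je orbT.
  set y := nth x0 _ _ in takeS; have ye : y \in e by rewrite -mem_enum mem_nth.
  have [j jy] := enum_val_surj (fintype.subsetP (hedge_sub eH) y ye).
  move=> sub; have : c i 'X_j.
    apply/sub/monomial_idealX/wt_gt0P; exists j; last by rewrite mnm1E eqxx.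
    by rewrite inE takeS jy mem_rcons mem_head.
  move=> /monomial_idealX/wt_gt0P[l]; rewrite inE mnm1E lt0b => le /eqP jl.
  have := enum_uniq e; rewrite -(cat_take_drop i.+1 (enum e)) cat_uniq takeS.
  by rewrite rcons_uniq -jy jl le.
- congr var_ideal; apply/setP => x.
  by rewrite inE cardE take_size mem_enum.
- exact: var_ideal_prime.
Qed.

End CoverIdeal.
(** * Covers from colourings *)

Section Colouring.
Variables (T : finType) (H : hypergraph T) (h : nat).
Hypothesis edge_le : forall e, e \in hedge H -> (#|e| <= h)%N.
Implicit Types (m : 'X_{1..#|hvert H|}).

Lemma edge_exists : exists e, e \in hedge H.
Proof. exact/set0Pn/hedge_neq0. Qed.

Lemma chromatic_number_gt0 : (0 < chromatic_number H)%N.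
Proof.
rewrite /chromatic_number; case: ex_minnP => -[|//] /existsP[f _] _.
have [e /hedge_card/card_gt1P[x _]] := edge_exists.
by case: (f x).
Qed.

(** Colours are taken in nat, and j is arbitrary, so that the colouring can be
    used with any r at least the chromatic number as its number of colours. *)
Lemma chromatic_number_colouring : exists f : T -> nat,
  (forall x, (f x < chromatic_number H)%N) /\
  forall e j, e \in hedge H -> exists2 x, x \in e & f x != j.
Proof.
rewrite /chromatic_number; case: ex_minnP => k /existsP[f /forall_inP fP] _.
exists (fun x => nat_of_ord (f x)); split=> [x|e j eH]; first exact: ltn_ord.
have := fP e eH; rewrite negb_exists => /forallP ne.
have /card_gt1P[y [_ [ye _ _]]] := hedge_card eH.
have [jk|kj] := ltnP j k; last first.
  by exists y => //; rewrite ltn_eqF // (leq_trans _ kj).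
by have /forall_inPn[x xe fx] := ne (Ordinal jk); exists x.
Qed.

(** The parts c j of the splitting are covers because an edge missed by c j would
    have weight below (r - 1) h. *)
Lemma splits_chromatic r m : (chromatic_number H <= r)%N ->
  (forall e, e \in hedge H -> (r * h - h <= wt e m)%N) ->
  splits (@covers T H) r m.
Proof.
move=> chi_r; have [a ->] := mnm_of_surj m.
have r_gt0 : (0 < r)%N := leq_trans chromatic_number_gt0 chi_r.
have [f [f_lt fP]] := chromatic_number_colouring => wa.
pose c j := mnm_of (hvert H)
  (fun x => (r <= a x)%N || (r <= (a x).+1)%N && (f x != j)).
apply: (@splits_family _ _ _ c); first exact: upclosed_covers.
  move=> j _ e eH; rewrite lt0n; apply/eqP => w0.
  have c0 x : x \in e -> (a x < r)%N /\ (f x != j -> ((a x).+1 < r)%N).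
    move: w0; rewrite wt_mnm_of ?hedge_sub // => /eqP.
    rewrite sum_nat_eq0 => /forall_inP/[apply]; lia.
  have [x xe fx] := fP e j eH.
  (* If C_j misses e, then a <= r - 1 on e, strictly at a vertex not coloured j. *)
  have : (\sum_(x in e) a x < \sum_(x in e) r.-1)%N.
    rewrite (bigD1 x) //= [X in (_ < X)%N](bigD1 x) //= -addSn leq_add //.
      by have [_ /(_ fx)] := c0 x xe; lia.
    by apply: leq_sum => y /andP[/c0[ay _] _]; lia.
  rewrite sum_nat_const ltnNge => /negP; apply.
  apply: leq_trans (leq_mul (edge_le eH) (leqnn _)) _.
  have := wa e eH; rewrite wt_mnm_of ?hedge_sub //.
  by rewrite -[X in (_ - X)%N]mul1n -mulnBl mulnC subn1.
move=> i; rewrite mnm_ofE; under eq_bigr => j _ do rewrite mnm_ofE.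
set x := enum_val i; have [ra|ar] := leqP r (a x).
  by rewrite sum_nat_const card_ord muln1.
have [ra|ar'] /= := leqP r (a x).+1; last by rewrite big1.
have fr : (f x < r)%N := leq_trans (f_lt x) chi_r.
(* The vertex is left out of the cover indexed by its own colour. *)
rewrite (bigD1 (Ordinal fr)) //= eqxx add0n.
apply: (@leq_trans (\sum_(j < r | j != Ordinal fr) 1)%N).
  by apply: leq_sum => j _; case: (_ != _).
by rewrite sum1_card cardC1 card_ord; lia.
Qed.

(** With b = a / n rounded down, n * wt e b >= wt e a - #|e| (n - 1) exceeds
    n (chi h - h - 1), so b has weight at least chi h - h on every edge and
    splits into chi covers. *)
Lemma splits_chromatic_mul n m :
  (forall e, e \in hedge H ->
     (n * (chromatic_number H * h - 1) <= wt e m)%N) ->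
  splits (@covers T H) (n * chromatic_number H) m.
Proof.
case: n => [//|n].
have [a ->] := mnm_of_surj m => wa.
apply: (@splits_mul _ _ _ _ (mnm_of (hvert H) (fun x => a x %/ n.+1)%N)).
- exact: upclosed_covers.
- apply: splits_chromatic => // e eH; have := wa e eH.
  have e_gt0 : (0 < #|e|)%N := ltnW (hedge_card eH).
  rewrite !wt_mnm_of ?hedge_sub // => we.
  have : (\sum_(x in e) a x <= \sum_(x in e) (n.+1 * (a x %/ n.+1) + n))%N.
    apply: leq_sum => x _; rewrite {1}(divn_eq (a x) n.+1) mulnC leq_add2l.
    by rewrite -ltnS ltn_mod.
  rewrite big_split /= sum_nat_const -big_distrr /=.
  move: (\sum_(x in e) _ %/ _)%N => b.
  have := edge_le eH; have := chromatic_number_gt0.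
  move: (chromatic_number H) #|e| (\sum_(x in e) a x)%N e_gt0 we => k d s; nia.
- by move=> i; rewrite !mnm_ofE mulnC leq_divM.
Qed.

End Colouring.

(** * Subhypergraphs *)

Section Subhypergraph.
Variables (T : finType) (H' H : hypergraph T).
Hypothesis H'H : subhypergraph H' H.

Lemma splits_subhypergraph t a :
  splits (@covers T H) t (mnm_of (hvert H) a) ->
  splits (@covers T H') t (mnm_of (hvert H') a).
Proof.
have [VV EE _] := H'H.
elim: t a => [//|t IH] a [u [v [Uu Uv]]].
have [b bu] := mnm_of_surj u; have [d dv] := mnm_of_surj v.
move=> /mnmP abd; exists (mnm_of _ b), (mnm_of _ d); split.
- move=> e eH'; have eH := fintype.subsetP EE e eH'.
  by have := Uu e eH; rewrite bu !wt_mnm_of ?hedge_sub.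
- by apply: IH; rewrite -dv.
- apply/mnmP => i; rewrite mnmDE !mnm_ofE.
  have [j <-] := enum_val_surj (fintype.subsetP VV _ (enum_valP i)).
  by have := abd j; rewrite bu dv mnmDE !mnm_ofE.
Qed.

Lemma symbolic_subhypergraph (K : fieldType) s t :
  symbolic_power (cover_ideal K H) s `<=` ideal_pow (cover_ideal K H) t ->
  symbolic_power (cover_ideal K H') s `<=` ideal_pow (cover_ideal K H') t.
Proof.
have [VV EE EP] := H'H.
rewrite !symbolic_power_cover !cover_ideal_pow => sub f sf m mf.
have := sf m mf; have [a ->] := mnm_of_surj m => wa.
pose b x := (if x \in hvert H' then a x else s).
have -> : mnm_of (hvert H') a = mnm_of (hvert H') b.
  by apply/mnmP => i; rewrite !mnm_ofE /b enum_valP.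
apply: splits_subhypergraph; apply/(@monomial_idealX K)/sub/monomial_idealX.
move=> e eH; rewrite wt_mnm_of ?hedge_sub //.
have [eV|/fintype.subsetPn[x xe xV]] := boolP (e \subset hvert H').
  apply: leq_trans (wa e _) _; first by rewrite EP.
  rewrite wt_mnm_of //; apply: leq_sum => x xe.
  by rewrite /b (fintype.subsetP eV).
by rewrite (bigD1 x) //= /b (negPf xV) leq_addr.
Qed.

End Subhypergraph.

(** * The containments and the resurgence bounds *)

Local Open Scope ereal_scope.

Theorem theorem1p1 (K : fieldType) (F : realType) (T : finType)
    (H : hypergraph T) :
  (forall h : nat, big_height (cover_ideal K H) h ->
     (forall r : nat, (chromatic_number H <= r)%N ->
        symbolic_power (cover_ideal K H) (r * h - h)%N
          `<=` ideal_pow (cover_ideal K H) r)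
     /\ asymptotic_resurgence F (cover_ideal K H)
          <= (h%:R - (chromatic_number H)%:R^-1 : F)%R%:E)
  /\
  (forall H' : hypergraph T, subhypergraph H' H ->
     resurgence F (cover_ideal K H') <= resurgence F (cover_ideal K H)
     /\ asymptotic_resurgence F (cover_ideal K H')
          <= asymptotic_resurgence F (cover_ideal K H)).
Proof.
split=> [h hH|H' H'H]; last first.
  split; apply: ereal_sup_le => _ [s [t [s0 t0 nsub ->]]]; exists s, t; split=> //.
    by move=> /(symbolic_subhypergraph H'H).
  by have [N nN] := nsub; exists N => r /nN nr /(symbolic_subhypergraph H'H).
have edge_le e : e \in hedge H -> (#|e| <= h)%N by apply: big_height_edge hH.
split=> [r chi_r|].
  rewrite symbolic_power_cover cover_ideal_pow => f wf m /wf.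
  exact: splits_chromatic.
apply: ge_ereal_sup => _ [s [t [s0 t0 [N nsub] ->]]].
have chi_gt0 := chromatic_number_gt0 H.
set k := chromatic_number H in chi_gt0 *.
rewrite lee_fin leNgt; apply/negP => lt_st.
have kF : (0 < k%:R :> F)%R by rewrite ltr0n.
have tF : (0 < t%:R :> F)%R by rewrite ltr0n.
have st : (h * k * t < s * k + t)%N.
  rewrite -(ltr_nat F) natrD !natrM.
  have : ((h%:R - k%:R^-1) * t%:R * k%:R < s%:R * k%:R :> F)%R.
    by rewrite ltr_pM2r // -ltr_pdivlMr.
  rewrite -ltrBlDr; congr (_ < _)%R; field.
  exact: lt0r_neq0.
(* A multiple of the chromatic number, beyond the threshold N. *)
apply: (nsub (k * N)%N); first by rewrite leq_pmull.
rewrite symbolic_power_cover cover_ideal_pow => f wf m mf.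
have -> : (t * (k * N) = t * N * k)%N by rewrite mulnA mulnAC.
apply: (splits_chromatic_mul edge_le) => e eH.
apply: leq_trans (wf m mf e eH); rewrite -/k.
have : (t * (k * h - 1) <= s * k)%N by nia.
by move=> /(leq_mul (leqnn N)); lia.
Qed.
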